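(* Let $\mathbf{x}$ be a sequence over a finite alphabet. Then $r_{\mathbf{x}} (n) \leq r_{\mathbf{x}} (n+2)$ for all $n \geq 0$.
   Context: A factor of a sequence is a finite contiguous block. For $u=u(1)\cdots u(m)$, $u^R=u(m)\cdots u(1)$. $r_{\mathbf{x}}(n)$ is the number of distinct length-$n$ factors of $\mathbf{x}$ up to the equivalence $u\sim v\iff v\in\{u,u^R\}$. *)

(* Defs.v *)
From mathcomp Require Import all_boot.
From mathcomp Require Import boolp.

Set Implicit Arguments.
Unset Strict Implicit.
Unset Printing Implicit Defensive.

Section ReflectionComplexity.
Variable A : finType.

Definition is_factor (x : nat -> A) (w : seq A) : Prop :=
  exists i : nat, w = mkseq (fun j => x (i + j)) (size w).

Definition factors (x : nat -> A) (n : nat) : {set n.-tuple A} :=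
  [set w : n.-tuple A | `[< is_factor x w >]].

Definition refl_equiv (n : nat) : rel (n.-tuple A) :=
  fun u v => (v == u) || (v == [tuple of rev u]).

(* The classes live inside the set of factors: the reversal of a factor need
   not be a factor, in which case the class is a singleton. *)
Definition reflection_complexity (x : nat -> A) (n : nat) : nat :=
  #|equivalence_partition (@refl_equiv n) (factors x n)|.

Lemma refl_equiv_equivalence (n : nat) : equivalence_rel (@refl_equiv n).
Proof.
have revK : involutive (fun u : n.-tuple A => [tuple of rev u]).
  by move=> u; apply: val_inj; rewrite /= revK.
move=> u v w; rewrite /refl_equiv; split; first by rewrite eqxx.
by case/orP=> /eqP -> //; rewrite revK orbC.
Qed.

End ReflectionComplexity.

(* Main.v *)
(** Deleting the first and the last letter sends classes of factors of length
    [n + 2] to classes of factors of length [n]; write [c i] for the class of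
    the factor of length [n] at position [i].  Only [c 0] can be missed by this
    map.  If the map is injective, then [c (i + 1) = c (j + 1)] forces [c i] to be
    [c j] or [c (j + 2)], so a repetition in the sequence [c] (there is one, by
    pigeonhole) can be pushed down to position [0]: [c 0] recurs and the map
    is onto.  If it is not injective, the loss of [c 0] is compensated by the
    collision. *)
Require Import Defs.
From mathcomp Require Import all_boot.
From mathcomp Require Import boolp zify.

Set Implicit Arguments.
Unset Strict Implicit.
Unset Printing Implicit Defensive.

(** The blocks are the nonempty traces on [D] of the fibres of [k], so each one determines its value
    of [k]. *)
Lemma card_equivalence_partition_imset (T U : finType) (R : rel T)
    (k : T -> U) (D : {set T}) :
  (forall u v, R u v = (k u == k v)) ->
  #|equivalence_partition R D| = #|k @: D|.
Proof.
move=> Rk.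
have -> : equivalence_partition R D
    = (fun c => [set v in D | c == k v]) @: (k @: D).
  rewrite -imset_comp; apply: eq_imset => u /=.
  by apply/setP => v; rewrite !inE Rk.
apply: card_in_imset => _ _ /imsetP[u uD ->] /imsetP[v _ ->] /setP/(_ u).
by rewrite !inE uD eqxx => /esym/eqP.
Qed.

Lemma pigeonhole_seq (T : finType) (f : nat -> T) :
  exists i j, i < j /\ f i = f j.
Proof.
have : ~~ injectiveb (fun i : 'I_#|T|.+1 => f i).
  by apply/negP => /injectiveP/leq_card; rewrite card_ord ltnn.
case/injectivePn => i [j ij fij].
by case: (ltngtP i j) => [lt|lt|/val_inj e];
  [exists i, j | exists j, i | rewrite e eqxx in ij].
Qed.

Section ReflectionClasses.
Variable A : finType.

(** A complete invariant of [refl_equiv]. It is not cut down to the factors of a sequence: keeping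
    both words always lets the central window commute with forming the class. *)
Definition refl_class n (u : n.-tuple A) : {set n.-tuple A} :=
  [set u; [tuple of rev u]].

Lemma rev_tupleK n : involutive (fun u : n.-tuple A => [tuple of rev u]).
Proof. by move=> u; apply: val_inj; rewrite /= revK. Qed.

Lemma refl_classP n (u v : n.-tuple A) :
  reflect (u = v \/ u = [tuple of rev v]) (refl_class u == refl_class v).
Proof.
apply: (iffP eqP) => [/setP/(_ u)|[->//|->]].
  by rewrite !inE eqxx => /esym/orP[]/eqP; [left|right].
by rewrite /refl_class rev_tupleK setUC.
Qed.

Lemma refl_equivE n (u v : n.-tuple A) :
  refl_equiv u v = (refl_class u == refl_class v).
Proof.
apply/orP/refl_classP => [[]/eqP->|[]->]; rewrite ?rev_tupleK ?eqxx; by auto.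
Qed.

(* Meaningful only for [k <= 2]; beyond that [inord] truncates to index [0]. *)
Definition window n k (w : n.+2.-tuple A) : n.-tuple A :=
  [tuple tnth w (inord (k + j)) | j < n].

Lemma window_rev n k (w : n.+2.-tuple A) : k <= 2 ->
  window k [tuple of rev w] = [tuple of rev (window (2 - k) w)].
Proof.
(* The default letter for [nth] comes from [w], which is nonempty even when [n] is 0. *)
move=> k2; apply: eq_from_tnth => j; have a0 := tnth w ord0.
rewrite tnth_mktuple !(tnth_nth a0).
have jn := ltn_ord j.
rewrite [LHS]nth_rev ?[RHS]nth_rev ?size_tuple ?inordK //; try lia.
have sj : n - j.+1 < n by lia.
rewrite (nth_mktuple _ a0 (Ordinal sj)) (tnth_nth a0) inordK /=; last by lia.
by congr nth; lia.
Qed.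

(** Reversal swaps the two outer windows and fixes the central one, as 2 - 1 = 1. *)
Lemma imset_window_refl_class n (w : n.+2.-tuple A) :
  window 1 @: refl_class w = refl_class (window 1 w).
Proof. by rewrite /refl_class imsetU1 imset_set1 window_rev. Qed.

Variable x : nat -> A.

Definition factor_at n i : n.-tuple A := [tuple x (i + j) | j < n].

Lemma window_factor_at n k i : k <= 2 ->
  window k (factor_at n.+2 i) = factor_at n (i + k).
Proof.
move=> k2; apply: eq_from_tnth => j; have jn := ltn_ord j.
by rewrite !tnth_mktuple inordK ?addnA //; lia.
Qed.

Lemma factorsP n (w : n.-tuple A) :
  reflect (exists i, w = factor_at n i) (w \in factors x n).
Proof.
have val_factor i : val (factor_at n i) = mkseq (fun j => x (i + j)) n.
  by rewrite /mkseq -val_enum_ord -map_comp.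
rewrite inE; apply: (iffP (asboolP _)) => -[i]; rewrite ?size_tuple => wi.
  by exists i; apply: val_inj; rewrite val_factor.
by exists i; rewrite size_tuple wi -val_factor.
Qed.

Definition class_at n i := refl_class (factor_at n i).

Definition factor_classes n := @refl_class n @: factors x n.

Lemma reflection_complexityE n :
  reflection_complexity x n = #|factor_classes n|.
Proof. exact/card_equivalence_partition_imset/refl_equivE. Qed.

Lemma factor_classesP n C :
  reflect (exists i, C = class_at n i) (C \in factor_classes n).
Proof.
apply: (iffP imsetP) => [[_ /factorsP[i ->] ->]|[i ->]]; first by exists i.
by exists (factor_at n i) => //; apply/factorsP; exists i.
Qed.

Definition trim_class n (C : {set n.+2.-tuple A}) := window 1 @: C.

Lemma trim_class_at n i : trim_class (class_at n.+2 i) = class_at n i.+1.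
Proof.
by rewrite /trim_class imset_window_refl_class window_factor_at // addn1.
Qed.

(** Compare prefixes of length [n]: the one at [i] is the prefix at [j] or, in the reversed case,
    the reversal of the suffix, which starts at [j.+2]. *)
Lemma class_at_neighbour n i j : class_at n.+2 i = class_at n.+2 j ->
  class_at n i = class_at n j \/ class_at n i = class_at n j.+2.
Proof.
have win0 : factor_at n i = window 0 (factor_at n.+2 i).
  by rewrite window_factor_at // addn0.
move/eqP/refl_classP => -[] e; [left | right]; apply/eqP/refl_classP.
  by left; rewrite win0 e window_factor_at // addn0.
by right; rewrite win0 e window_rev // window_factor_at // addn2.
Qed.

Lemma trim_class_inj_recurrent n :
  {in factor_classes n.+2 &, injective (@trim_class n)} ->
  exists j, class_at n 0 = class_at n j.+1.
Proof.
move=> trim_inj.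
(* Lowering [i] by one lowers [j] by one or, in the reversed case, raises it by one. Hence [j] is
   generalised; [i < j] survives both ways. *)
have descent i : forall j, i < j -> class_at n i = class_at n j ->
    exists j', class_at n 0 = class_at n j'.+1.
  elim: i => [|i IHi] [|j] // ij; first by exists j.
  rewrite -!trim_class_at => /trim_inj e.
  have {e} /class_at_neighbour[] : class_at n.+2 i = class_at n.+2 j.
  - by apply: e; apply/factor_classesP; [exists i | exists j].
  - exact: IHi.
  - by apply: IHi; lia.
have [i [j [ij e]]] := pigeonhole_seq (class_at n).
exact: descent ij e.
Qed.

End ReflectionClasses.

Theorem theorem3p17 (A : finType) (x : nat -> A) (n : nat) :
  reflection_complexity x n <= reflection_complexity x n.+2.
Proof.
rewrite !reflection_complexityE.
set F := factor_classes x n; set F2 := factor_classes x n.+2.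
have trimF i : class_at x n i.+1 \in @trim_class A n @: F2.
  by rewrite -trim_class_at imset_f //; apply/factor_classesP; exists i.
have [[j c0j]|c0_once] := pselect (exists j, class_at x n 0 = class_at x n j.+1).
  apply: leq_trans (leq_imset_card (@trim_class A n) _).
  apply/subset_leq_card/subsetP => _ /factor_classesP[[|i] ->] //.
  by rewrite c0j.
have lt_trim : #|@trim_class A n @: F2| < #|F2|.
  rewrite ltn_neqAle leq_imset_card andbT.
  by apply/negP => /imset_injP/trim_class_inj_recurrent.
apply: leq_trans lt_trim.
(* The class at position 0 contributes at most 1, which the strict inequality pays for; all other
   classes lie in the image of [trim_class]. *)
rewrite (cardsD1 (class_at x n 0)).
apply: leq_add (leq_b1 _) _.
apply/subset_leq_card/subsetP => C /setD1P[neq0 /factor_classesP[[|i] e]].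
  by rewrite e eqxx in neq0.
by rewrite e.
Qed.
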